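(* Let $A\in\mathbb{C}^{n\times n}$ be coninvolutory, i.e. $A\overline{A}=I_n$, and write $n=2m$ or $n=2m+1$ with $m$ a nonnegative integer. Let $\nu$ be the number (with multiplicity) of singular values of $A$ that are $>1$, denoted $\sigma_1\ge\cdots\ge\sigma_\nu>1$, and put $S=\operatorname{diag}(\sigma_1,\dots,\sigma_\nu)$. Assume that $A$ has $\mu\ge0$ pairs $(1,1)$ of singular values $1$ associated with the singular triplets $(u_{\nu+j},v_{\nu+j},1)$ and $(\overline{v}_{\nu+j},\overline{u}_{\nu+j},1)$, $j=1,\dots,\mu$, where the $2\mu$ vectors $v_{\nu+1},\dots,v_{\nu+\mu},\overline{u}_{\nu+1},\dots,\overline{u}_{\nu+\mu}$ are orthonormal. Define $\eta=m-\nu-\mu$, and $\delta=\eta$ if $n=2m$, $\delta=\eta+1$ if $n=2m+1$. Then $\eta\ge0$, and there exist vectors $u_1,\dots,u_\nu,v_1,\dots,v_\nu$ and $u_{\nu+\mu+1},\dots,u_{\nu+\mu+\delta+\eta}$ in $\mathbb{C}^n$ and real numbers $\alpha_1,\dots,\alpha_{\delta+\eta}$ such that: (i) the singular values $>1$ appear in pairs $(\sigma_j,\frac1{\sigma_j})$ associated with the singular triplets $(u_j,v_j,\sigma_j)$ and $(\overline{v}_j,\overline{u}_j,\frac1{\sigma_j})$, $j=1,\dots,\nu$; (ii) the remaining $k=n-2\nu-2\mu=\delta+\eta$ singular values are single singular values $1$ associated with the singular triplets $(u_{\nu+\mu+j},\,e^{\imath\alpha_j}\overline{u}_{\nu+\mu+j},\,1)$,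 $j=1,\dots,k$; (iii) $A=U\Sigma V^H$ is a singular value decomposition of $A$ (with $U,V$ unitary), where $$\Sigma=\operatorname{diag}(S,\,I_\mu,\,I_\delta,\,S^{-1},\,I_\mu,\,I_\eta),$$ $$U=[u_1,\dots,u_\nu,\ u_{\nu+1},\dots,u_{\nu+\mu},\ u_{\nu+\mu+1},\dots,u_{\nu+\mu+\delta},\ \overline{v}_1,\dots,\overline{v}_\nu,\ \overline{v}_{\nu+1},\dots,\overline{v}_{\nu+\mu},\ u_{\nu+\mu+\delta+1},\dots,u_{\nu+\mu+\delta+\eta}],$$ $$V=[v_1,\dots,v_\nu,\ v_{\nu+1},\dots,v_{\nu+\mu},\ e^{\imath\alpha_1}\overline{u}_{\nu+\mu+1},\dots,e^{\imath\alpha_\delta}\overline{u}_{\nu+\mu+\delta},\ \overline{u}_1,\dots,\overline{u}_\nu,\ \overline{u}_{\nu+1},\dots,\overline{u}_{\nu+\mu},\ e^{\imath\alpha_{\delta+1}}\overline{u}_{\nu+\mu+\delta+1},\dots,e^{\imath\alpha_{\delta+\eta}}\overline{u}_{\nu+\mu+\delta+\eta}].$$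
   Context: $\imath=\sqrt{-1}$; $\overline{X}$ is the entrywise complex conjugate and $X^H$ the conjugate transpose; $I_j$ is the $j\times j$ identity matrix. A singular value decomposition of $A\in\mathbb{C}^{n\times n}$ is $A=U\Sigma V^H$ with $U,V\in\mathbb{C}^{n\times n}$ unitary and $\Sigma$ diagonal with nonnegative real diagonal entries, the singular values; here the diagonal of $\Sigma$ need not be sorted by magnitude. A singular triplet of $A$ is $(u,v,\sigma)$ with $u$ a left and $v$ a right singular vector of $A$ for the singular value $\sigma$: $u,v\in\mathbb{C}^n$ are unit vectors with $Av=\sigma u$ and $A^Hu=\sigma v$. Empty blocks (size $0$) are allowed. *)

(* Defs.v *)
(* MathComp world; cos and sin come from MathComp-Analysis. *)
From mathcomp Require Import all_boot all_order all_algebra.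
From mathcomp Require Import complex spectral boolp classical_sets reals trigo.
Set Implicit Arguments.
Unset Strict Implicit.
Unset Printing Implicit Defensive.
Import Order.TTheory GRing.Theory Num.Theory Num.Def.
Local Open Scope ring_scope.
Local Open Scope complex_scope.
Local Open Scope sesquilinear_scope.
Local Open Scope classical_set_scope.

Notation conj_mx := (map_mx Num.conj).

(* e^(i a) *)
Definition expi (R : realType) (a : R) : R[i] := cos a +i* sin a.

(* A = U *m diag(d) *m V^H with unitary U, V; the nonnegative real diagonal d
   is not required to be sorted. *)
Definition is_svd (R : realType) (n : nat) (A U V : 'M[R[i]]_n)
    (d : 'rV[R]_n) : Prop :=
  [/\ U \is unitarymx, V \is unitarymx, forall i, 0 <= d 0 i
    & A = U *m diag_mx (map_mx (real_complex R) d) *m V ^t*].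

(* The singular values with multiplicity: the diagonal of a chosen singular
   value decomposition.  The choice only affects the order of the sequence,
   which is left unspecified.  The default 0 is used only when A has no
   decomposition, which never happens. *)
Definition singular_values (R : realType) (n : nat) (A : 'M[R[i]]_n) : seq R :=
  let d := xget 0 [set d : 'rV[R]_n | exists U V, is_svd A U V d] in
  [seq d 0 i | i : 'I_n].

Definition singular_triplet (R : realType) (n : nat) (A : 'M[R[i]]_n)
    (u v : 'cV[R[i]]_n) (s : R) : Prop :=
  [/\ 0 <= s, u ^t* *m u = 1%:M, v ^t* *m v = 1%:M,
      A *m v = s%:C *: u & A ^t* *m u = s%:C *: v].

(* unitarymx is not usable directly here: it asks for orthonormal rows. *)
Definition orthonormal_cols (R : realType) (n p : nat)
    (X : 'M[R[i]]_(n, p)) : Prop :=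
  X ^t* *m X = 1%:M.

(* Main.v *)
Require Import Defs.
From mathcomp Require Import all_boot all_order all_algebra.
From mathcomp Require Import complex spectral boolp classical_sets reals trigo.
From mathcomp Require Import zify.
Set Implicit Arguments.
Unset Strict Implicit.
Unset Printing Implicit Defensive.
Import Order.TTheory GRing.Theory Num.Theory Num.Def.
Local Open Scope ring_scope.
Local Open Scope complex_scope.
Local Open Scope sesquilinear_scope.

(** Write [J y] for the entrywise conjugate of [A y].  Since [A] times its
    conjugate is the identity, [J] is an antilinear involution of C^n.

    Pairing.  Conjugating [A v = s u] and [A^H u = s v] and cancelling one
    factor with [A conj(A) = 1] gives [A conj(u) = s^-1 conj(v)] and
    [A^H conj(v) = s^-1 conj(u)] ([singular_family_conj]).  So the singular
    vectors for the singular values [> 1], read off any singular value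
    decomposition, come with partners for the inverses [< 1], and right singular
    vectors for different singular values are orthogonal
    ([singular_family_orth]).  Together with the given pairs for the value 1 they
    form an orthonormal system [X] of [2 (nu + mu)] right singular vectors
    ([paired_orthonormal]); hence [2 (nu + mu) <= n], which is [eta >= 0].

    The rest has singular value 1.  The columns of [X] are permuted by [J] up to
    scaling, so [J] preserves the orthogonal complement F of [X]
    ([conact_stable_family]).  F is orthogonal to all singular vectors for
    singular values [> 1], so [A], and with it [J], does not increase norms on
    F.  As [J] is an involution of F it must preserve norms, and the equality
    case of the contraction estimate says that [A^H A] is the identity on F
    ([svd_contraction], [conact_orth_fixed]).

    Single values.  On F the map [J] is therefore an antiunitary involution, that
    is, a real structure, and F has an orthonormal basis of [J]-fixed vectors,
    found one vector at a time ([conact_fixed_basis]).  A fixed vector [w] has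
    [A w = conj(w)] and [A^H conj(w) = w], so with [u = conj(w)] it is the triplet
    [(u, conj(u), 1)]: all the phases [alpha] can be taken to be 0.

    The multiset of singular values does not depend on the decomposition, because
    their squares are the roots of the characteristic polynomial of [A^H A]
    ([svd_unique]).  This identifies the sequence [singular_values A] with the
    diagonal built here. *)

(** * Conjugate transposes and orthogonal vectors *)

Section Adjoint.
Variable C : numClosedFieldType.

Lemma adjM m n p (X : 'M[C]_(m, n)) (Y : 'M[C]_(n, p)) :
  (X *m Y) ^t* = Y ^t* *m X ^t*.
Proof. by rewrite trmx_mul map_mxM. Qed.

Lemma conj_mxK m n (X : 'M[C]_(m, n)) : conj_mx (conj_mx X) = X.
Proof. by apply/matrixP => i j; rewrite !mxE conjCK. Qed.

Lemma adj_conj m n (X : 'M[C]_(m, n)) : (conj_mx X) ^t* = conj_mx (X ^t*).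
Proof. by apply/matrixP => i j; rewrite !mxE. Qed.

Lemma adj_row_mx m n p (X : 'M[C]_(m, n)) (Y : 'M[C]_(m, p)) :
  (row_mx X Y) ^t* = col_mx (X ^t*) (Y ^t*).
Proof. by rewrite tr_row_mx map_col_mx. Qed.

Lemma eq_cols m n (X Y : 'M[C]_(m, n)) :
  (forall j, col j X = col j Y) -> X = Y.
Proof. by move=> e; apply: trmx_inj; apply/row_matrixP => j; rewrite -!tr_col e. Qed.

Lemma adj_mul_self n (y : 'cV[C]_n) :
  (y ^t* *m y) 0 0 = \sum_i `|y i 0| ^+ 2.
Proof. by rewrite mxE; apply: eq_bigr => i _; rewrite !mxE normCKC. Qed.

Lemma adj_orth_sym n p q (X : 'M[C]_(n, p)) (Y : 'M[C]_(n, q)) :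
  X ^t* *m Y = 0 -> Y ^t* *m X = 0.
Proof. by move=> /(congr1 (fun M => M ^t*)); rewrite adjM trmxCK trmx0 map_mx0. Qed.

Lemma adj_mul_eq0 n (y : 'cV[C]_n) : (y ^t* *m y == 0) = (y == 0).
Proof.
apply/eqP/eqP => [/matrixP/(_ 0 0)|->]; last by rewrite mulmx0.
rewrite adj_mul_self mxE => /eqP.
rewrite psumr_eq0 => [/allP h|i _]; last exact: exprn_ge0.
apply/colP => i; have := h i; rewrite mem_index_enum => /(_ isT) /=.
by rewrite expf_eq0 /= normr_eq0 mxE => /eqP.
Qed.

Lemma nonzero_orthogonal_vector n p (X : 'M[C]_(n, p)) : (p < n)%N ->
  exists2 y : 'cV[C]_n, y != 0 & X ^t* *m y = 0.
Proof.
move=> ltpn; set K := kermx (conj_mx X).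
exists (nz_row K)^T.
  rewrite -(inj_eq (@trmx_inj _ _ _)) trmxK trmx0 nz_row_eq0.
  rewrite -mxrank_eq0 mxrank_ker subn_eq0 -ltnNge.
  by rewrite (leq_ltn_trans _ ltpn) ?rank_leq_col.
apply: trmx_inj; rewrite trmx_mul trmxK trmx0 map_trmx trmxK.
by have /sub_kermxP := nz_row_sub K.
Qed.
End Adjoint.

(** * Characteristic polynomials and reindexing *)

Lemma char_poly_similar (F : comNzRingType) n (P Q B : 'M[F]_n) :
  P *m Q = 1%:M -> char_poly (P *m B *m Q) = char_poly B.
Proof.
move=> PQ; have : map_mx (@polyC F) P *m map_mx (@polyC F) Q = 1%:M.
  by rewrite -map_mxM PQ map_mx1.
rewrite /char_poly /char_poly_mx !map_mxM /=.
move: (map_mx _ P) (map_mx _ Q) (map_mx _ B) => P' Q' B' PQ'.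
have -> : 'X%:M - P' *m B' *m Q' = P' *m ('X%:M - B') *m Q'.
  by rewrite mulmxBr mulmxBl scalar_mxC -[_ *m P' *m Q']mulmxA PQ' mulmx1.
by rewrite !det_mulmx mulrAC -det_mulmx PQ' det1 mul1r.
Qed.

(** Two equal values of [f] may come from different indices, so this is what
    turns an equality of multisets of values into a choice of indices. *)
Lemma perm_map_lift (S T : eqType) (f : S -> T) (t : seq T) (s : seq S) :
  perm_eq t (map f s) -> exists2 s', perm_eq s' s & t = map f s'.
Proof.
case: s => [/perm_nilP -> | x s]; first by exists [::].
move=> /(perm_iotaP (f x))[Is pIs ->]; exists (map (nth x (x :: s)) Is).
  by apply/(perm_iotaP x); exists Is => //; move: pIs; rewrite size_map.
rewrite -map_comp; apply/eq_in_map => i.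
rewrite (perm_mem pIs) mem_iota add0n size_map => /andP[_ lti].
by rewrite (nth_map x).
Qed.

(** Finds, inside a full list of singular values, the positions of those [> 1]
    in a prescribed order.  The last conjunct, that no position is missed, is
    where the multiplicities are used. *)
Lemma select_indices (T : eqType) n p (d : 'I_n -> T) (s : 'I_p -> T)
    (P : pred T) :
  perm_eq [seq s j | j : 'I_p] [seq x <- [seq d i | i : 'I_n] | P x] ->
  exists f : 'I_p -> 'I_n,
    [/\ injective f, forall j, s j = d (f j) &
        forall i, P (d i) -> exists j, i = f j].
Proof.
rewrite filter_map => /perm_map_lift[s' ps' eqs].
have sz : size s' == p by rewrite -(size_map d) -eqs size_map size_enum_ord.
pose t := Tuple sz; exists (tnth t); split.
- by apply/tuple_uniqP; rewrite (perm_uniq ps') filter_uniq ?enum_uniq.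
- move=> j; move: eqs; rewrite -[s'](map_tnth_enum t) -map_comp.
  by move/eq_in_map/(_ j); apply; rewrite mem_enum.
- move=> i Pi; apply/tnthP; rewrite (perm_mem ps') mem_filter mem_enum.
  by rewrite /= Pi.
Qed.

(** * Families of singular vectors *)

Section Singular.
Variable C : numClosedFieldType.

Definition orthonormal n p (X : 'M[C]_(n, p)) := X ^t* *m X = 1%:M.

(** The columns of [U] and [V] need not be normalized, and the families need not
    be complete.  The diagonal takes values in the closed field itself, where
    being nonnegative includes being real. *)
Definition singular_family n p (A : 'M[C]_n) (U V : 'M[C]_(n, p)) (d : 'rV[C]_p) :=
  [/\ forall i, 0 <= d 0 i, A *m V = U *m diag_mx d & A ^t* *m U = V *m diag_mx d].

Lemma conj_diag p (d : 'rV[C]_p) :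
  (forall i, 0 <= d 0 i) -> conj_mx (diag_mx d) = diag_mx d.
Proof.
move=> d0; rewrite map_diag_mx; congr diag_mx; apply/rowP => i.
by rewrite !mxE; exact: geC0_conj.
Qed.

Lemma adj_diag p (d : 'rV[C]_p) :
  (forall i, 0 <= d 0 i) -> (diag_mx d) ^t* = diag_mx d.
Proof. by rewrite tr_diag_mx; exact: conj_diag. Qed.

Lemma diag_inv p (d : 'rV[C]_p) : (forall i, 0 < d 0 i) ->
  diag_mx d *m diag_mx (map_mx (fun x => 1 / x) d) = 1%:M.
Proof.
move=> d0; rewrite mulmx_diag -diag_const_mx; congr diag_mx.
by apply/rowP => i; rewrite !mxE mul1r mulfV // gt_eqF.
Qed.

Lemma orthonormal_row_mx n p q (X : 'M[C]_(n, p)) (Y : 'M[C]_(n, q)) :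
  orthonormal (row_mx X Y) <->
  [/\ orthonormal X, orthonormal Y & X ^t* *m Y = 0].
Proof.
rewrite /orthonormal adj_row_mx mul_col_row scalar_mx_block; split.
  by move=> /eq_block_mx[].
by case=> -> -> XY; rewrite XY (adj_orth_sym XY).
Qed.

(** The theorem orders its blocks as two halves, while the construction completes
    the paired vectors by all the remaining ones at once. *)
Lemma orthonormal_shuffle n p q r s (P : 'M[C]_(n, p)) (Q : 'M[C]_(n, q))
    (Y : 'M[C]_(n, r)) (Z : 'M[C]_(n, s)) :
  orthonormal (row_mx (row_mx P Q) (row_mx Y Z)) ->
  orthonormal (row_mx (row_mx P Y) (row_mx Q Z)).
Proof.
case/orthonormal_row_mx => /orthonormal_row_mx[oP oQ PQ].
move=> /orthonormal_row_mx[oY oZ YZ]; rewrite adj_row_mx mul_col_row.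
move=> /eqP; rewrite block_mx_eq0 => /and4P[/eqP PY /eqP PZ /eqP QY /eqP QZ].
apply/orthonormal_row_mx; split; try exact/orthonormal_row_mx.
by rewrite adj_row_mx mul_col_row PQ PZ YZ (adj_orth_sym QY) block_mx0.
Qed.

Lemma orthonormal_conj n p (X : 'M[C]_(n, p)) :
  orthonormal X -> orthonormal (conj_mx X).
Proof. by rewrite /orthonormal adj_conj -map_mxM => ->; rewrite map_mx1. Qed.

Lemma orthonormal_colsub n p q (X : 'M[C]_(n, p)) (f : 'I_q -> 'I_p) :
  injective f -> orthonormal X -> orthonormal (colsub f X).
Proof.
rewrite /orthonormal => fi hX.
have -> : (colsub f X) ^t* *m colsub f X = mxsub f f (X ^t* *m X).
  by apply/matrixP => i j; rewrite !mxE; apply: eq_bigr => k _; rewrite !mxE.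
by rewrite hX; apply/matrixP => i j; rewrite !mxE (inj_eq fi).
Qed.

Lemma orthonormal_col n p (X : 'M[C]_(n, p)) j :
  orthonormal X -> orthonormal (col j X).
Proof.
move=> hX; rewrite colEsub; apply: orthonormal_colsub hX => x y _.
by rewrite (ord1 x) (ord1 y).
Qed.

Lemma orthonormal_leq n p (X : 'M[C]_(n, p)) : orthonormal X -> (p <= n)%N.
Proof.
move=> hX; have := mulmx_max_rank (X ^t*) X.
by rewrite hX mxrank1.
Qed.

Lemma singular_family_row n p q (A : 'M[C]_n) (U V : 'M[C]_(n, p)) (d : 'rV[C]_p)
    (U' V' : 'M[C]_(n, q)) (d' : 'rV[C]_q) :
  singular_family A U V d -> singular_family A U' V' d' ->
  singular_family A (row_mx U U') (row_mx V V') (row_mx d d').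
Proof.
move=> [h0 h1 h2] [h0' h1' h2']; split.
- by move=> i; rewrite mxE; case: split.
- by rewrite diag_mx_row mul_row_block !mulmx0 !(addr0, add0r) mul_mx_row h1 h1'.
- by rewrite diag_mx_row mul_row_block !mulmx0 !(addr0, add0r) mul_mx_row h2 h2'.
Qed.

Lemma singular_family_colsub n p q (A : 'M[C]_n) (U V : 'M[C]_(n, p)) (d : 'rV[C]_p)
    (f : 'I_q -> 'I_p) :
  singular_family A U V d ->
  singular_family A (colsub f U) (colsub f V) (\row_j d 0 (f j)).
Proof.
have h (X : 'M[C]_(n, p)) :
    colsub f X *m diag_mx (\row_j d 0 (f j)) = colsub f (X *m diag_mx d).
  by rewrite !mul_mx_diag; apply/matrixP => i j; rewrite !mxE.
by move=> [h0 h1 h2]; split=> [i||]; rewrite ?mxE // mulmx_colsub ?h1 ?h2 h.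
Qed.

Lemma singular_familyP n p (A : 'M[C]_n) (U V : 'M[C]_(n, p)) (d : 'rV[C]_p) :
  singular_family A U V d <->
  forall j, [/\ 0 <= d 0 j, A *m col j V = d 0 j *: col j U &
               A ^t* *m col j U = d 0 j *: col j V].
Proof.
have h (X : 'M[C]_(n, p)) j : col j (X *m diag_mx d) = d 0 j *: col j X.
  by rewrite mul_mx_diag; apply/colP => i; rewrite !mxE mulrC.
have hB (B : 'M[C]_n) (X : 'M[C]_(n, p)) j : B *m col j X = col j (B *m X).
  by rewrite !colE mulmxA.
split=> [[h0 h1 h2] j|hj]; first by split=> //; rewrite hB (h1, h2) h.
split=> [j||]; first by have [] := hj j.
  by apply: eq_cols => j; have [_ e _] := hj j; rewrite -hB h e.
by apply: eq_cols => j; have [_ _ e] := hj j; rewrite -hB h e.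
Qed.

Lemma singular_family_gram n p (A : 'M[C]_n) (U V : 'M[C]_(n, p)) (d : 'rV[C]_p) :
  singular_family A U V d -> A ^t* *m A *m V = V *m (diag_mx d *m diag_mx d).
Proof. by move=> [_ h1 h2]; rewrite -mulmxA h1 !mulmxA h2. Qed.

(** [U^H U D = U^H A V = (A^H U)^H V = D V^H V = D], and [D] is invertible. *)
Lemma singular_family_orthonormal_left n p (A : 'M[C]_n)
    (U V : 'M[C]_(n, p)) (d : 'rV[C]_p) :
  (forall i, 0 < d 0 i) -> singular_family A U V d ->
  orthonormal V -> orthonormal U.
Proof.
move=> d0 [h0 h1 h2] oV; rewrite /orthonormal.
rewrite -[LHS]mulmx1 -(diag_inv d0) mulmxA -[_ *m U *m _]mulmxA -h1 mulmxA.
by rewrite -[A]trmxCK -adjM h2 adjM adj_diag // -[_ *m _ *m V]mulmxA oV mulmx1.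
Qed.

(** Eigenvectors of the Hermitian matrix [A^H A] for different eigenvalues. *)
Lemma singular_family_orth n p q (A : 'M[C]_n) (U V : 'M[C]_(n, p)) (d : 'rV[C]_p)
    (U' V' : 'M[C]_(n, q)) (d' : 'rV[C]_q) :
  (forall i j, d 0 i != d' 0 j) ->
  singular_family A U V d -> singular_family A U' V' d' -> V ^t* *m V' = 0.
Proof.
move=> neq F F'; have [d0 _ _] := F; have [d0' _ _] := F'.
have : V ^t* *m (A ^t* *m A *m V') = (A ^t* *m A *m V) ^t* *m V'.
  by rewrite !adjM trmxCK !mulmxA.
rewrite (singular_family_gram F) (singular_family_gram F') !adjM !adj_diag //.
rewrite !mulmx_diag [LHS]mulmxA -[RHS]mulmxA; move: (_ *m V') => M.
rewrite mul_mx_diag mul_diag_mx => /matrixP e; apply/matrixP => i j.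
have := e i j; rewrite !mxE => /eqP.
rewrite mulrC -subr_eq0 -mulrBl mulf_eq0.
case/orP => [|/eqP //]; rewrite -!expr2 subr_eq0 eqrXn2 //.
by rewrite eq_sym (negbTE (neq i j)).
Qed.

Lemma orthonormal_unitary n (X : 'M[C]_n) : orthonormal X -> X \is unitarymx.
Proof. by move=> h; apply/unitarymxP/mulmx1C. Qed.

Definition has_svd n (A U V : 'M[C]_n) (d : 'rV[C]_n) :=
  [/\ U \is unitarymx, V \is unitarymx, forall i, 0 <= d 0 i &
      A = U *m diag_mx d *m V ^t*].

(** A singular value decomposition is the square case of a singular family. *)
Lemma has_svdP n (A U V : 'M[C]_n) (d : 'rV[C]_n) :
  has_svd A U V d <->
  [/\ orthonormal U, orthonormal V & singular_family A U V d].
Proof.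
split=> [[uU uV d0 defA]|[oU oV [d0 h1 h2]]].
  have oU : orthonormal U by apply/mulmx1C/unitarymxP.
  have oV : orthonormal V by apply/mulmx1C/unitarymxP.
  split=> //; split=> //; first by rewrite defA -mulmxA oV mulmx1.
  by rewrite defA !adjM adj_diag // trmxCK -!mulmxA oU mulmx1.
split=> //; try exact: orthonormal_unitary.
by rewrite -h1 -mulmxA (mulmx1C oV) mulmx1.
Qed.

(** The squared singular values are the roots of the characteristic polynomial of
    [A^H A]. *)
Lemma svd_unique n (A U V U' V' : 'M[C]_n) (d d' : 'rV[C]_n) :
  has_svd A U V d -> has_svd A U' V' d' ->
  perm_eq [seq d 0 i | i : 'I_n] [seq d' 0 i | i : 'I_n].
Proof.
have h (U0 V0 : 'M[C]_n) e : has_svd A U0 V0 e ->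
    (forall i, 0 <= e 0 i) /\
    char_poly (A ^t* *m A) = \prod_(x <- [seq e 0 i ^+ 2 | i : 'I_n]) ('X - x%:P).
  move=> S; have [_ oV F] := (has_svdP A U0 V0 e).1 S.
  split; first by case: F.
  have -> : A ^t* *m A = V0 *m (diag_mx e *m diag_mx e) *m V0 ^t*.
    by rewrite -(singular_family_gram F) -mulmxA (mulmx1C oV) mulmx1.
  rewrite char_poly_similar; last exact: mulmx1C.
  rewrite mulmx_diag char_poly_trig ?diag_mx_is_trig // big_map big_enum.
  by apply: eq_bigr => i _; rewrite !mxE eqxx mulr1n.
move=> /h[d0 eqA] /h[d0']; rewrite eqA => /prod_XsubC_eq/(perm_map sqrtC).
have r (e : 'rV[C]_n) : (forall i, 0 <= e 0 i) ->
    map sqrtC [seq e 0 i ^+ 2 | i : 'I_n] = [seq e 0 i | i : 'I_n].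
  by move=> e0; rewrite -map_comp; apply: eq_map => i /=; rewrite sqrCK.
by rewrite !r.
Qed.

(** The spectral theorem for [A^H A] provides [V] and [D]; when [A] is invertible,
    [D] is positive and [U = A V D^(-1/2)] completes the decomposition. *)
Lemma svd_exists n (A : 'M[C]_n) : A \in unitmx ->
  exists U V d, has_svd A U V d.
Proof.
move=> uA; set G := A ^t* *m A.
have /orthomx_spectralP : G \is normalmx.
  by apply/normalmxP; rewrite /G adjM trmxCK.
set P := spectralmx G; set D := spectral_diag G => defG.
have uP : P \is unitarymx by exact: spectral_unitarymx.
rewrite invmx_unitary // in defG; set V := P ^t* in defG.
have oV : orthonormal V by rewrite /orthonormal /V trmxCK; apply/unitarymxP.
have PV : P *m V = 1%:M by exact/unitarymxP.
have DE i : D 0 i = ((A *m col i V) ^t* *m (A *m col i V)) 0 0.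
  have -> : (A *m col i V) ^t* *m (A *m col i V) =
      (col i V) ^t* *m (G *m col i V) by rewrite adjM !mulmxA.
  rewrite defG colE; set e := delta_mx i 0.
  have -> : V *m diag_mx D *m P *m (V *m e) = V *m diag_mx D *m e.
    by rewrite mulmxA -[_ *m P *m V]mulmxA PV mulmx1.
  rewrite adjM !mulmxA -[_ *m V ^t* *m V]mulmxA oV mulmx1 -mulmxA.
  rewrite mul_diag_mx mxE (bigD1 i) //= big1 => [|k /negbTE ki]; rewrite !mxE.
    by rewrite !eqxx rmorph1 mul1r mulr1 addr0.
  by rewrite ki rmorph0 mul0r.
have D0 i : 0 < D 0 i.
  rewrite lt_def DE adj_mul_self sumr_ge0 ?andbT => [|k _]; last exact: exprn_ge0.
  rewrite -adj_mul_self; apply/negP => /eqP e0.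
  have : A *m col i V == 0.
    by rewrite -adj_mul_eq0; apply/eqP/matrixP => a b; rewrite !ord1 e0 mxE.
  move=> /eqP/(congr1 (mulmx (invmx A))); rewrite mulKmx // mulmx0 => vi0.
  have /matrixP/(_ 0 0) := orthonormal_col i oV.
  by rewrite vi0 mulmx0 !mxE /= => /esym/eqP; rewrite oner_eq0.
pose d := map_mx sqrtC D.
have d0 i : 0 < d 0 i by rewrite mxE sqrtC_gt0.
have dd : diag_mx d *m diag_mx d = diag_mx D.
  rewrite mulmx_diag; congr diag_mx; apply/rowP => i.
  by rewrite !mxE -expr2 sqrtCK.
pose U := A *m V *m diag_mx (map_mx (fun x => 1 / x) d).
have F : singular_family A U V d.
  split=> [i||]; first exact: ltW.
    by rewrite -[RHS]mulmxA (mulmx1C (diag_inv d0)) mulmx1.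
  rewrite !mulmxA -/G defG -[_ *m P *m V]mulmxA PV mulmx1.
  by rewrite -dd -!mulmxA diag_inv // mulmx1.
exists U, V, d; apply/has_svdP; split=> //.
exact: singular_family_orthonormal_left F oV.
Qed.

Lemma adj_mul_orthonormal n p q (V : 'M[C]_(n, p)) (X Y : 'M[C]_(p, q)) :
  orthonormal V -> (V *m X) ^t* *m (V *m Y) = X ^t* *m Y.
Proof. by move=> oV; rewrite adjM mulmxA -[_ *m V]mulmxA oV mulmx1. Qed.

(** In the coordinates [c] of [y] with respect to [V], the two squared norms are
    the sums of [|d_i c_i|^2] and of [|c_i|^2], where only indices with
    [d_i <= 1] contribute.  Equality forces [c_i = 0] whenever [d_i < 1]. *)
Lemma svd_contraction n (A U V : 'M[C]_n) (d : 'rV[C]_n) (y : 'cV[C]_n) :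
  has_svd A U V d -> (forall i, 1 < d 0 i -> (V ^t* *m y) i 0 = 0) ->
  ((A *m y) ^t* *m (A *m y)) 0 0 <= (y ^t* *m y) 0 0 /\
  ((y ^t* *m y) 0 0 <= ((A *m y) ^t* *m (A *m y)) 0 0 -> A ^t* *m A *m y = y).
Proof.
move=> S; have [oU oV F] := (has_svdP A U V d).1 S.
have [d0 AV _] := F => c0.
have defy : y = V *m (V ^t* *m y) by rewrite mulmxA (mulmx1C oV) mul1mx.
(* From here on only the coordinates [c] of [y] with respect to [V] matter. *)
move: (V ^t* *m y) c0 defy => c c0 defy.
have Ay : A *m y = U *m (diag_mx d *m c) by rewrite defy !mulmxA AV.
have Gy : A ^t* *m A *m y = V *m (diag_mx d *m diag_mx d *m c).
  by rewrite defy !mulmxA (singular_family_gram F) !mulmxA.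
rewrite Gy Ay defy (adj_mul_orthonormal _ _ oU) (adj_mul_orthonormal _ _ oV).
rewrite !adj_mul_self.
have le i : `|(diag_mx d *m c) i 0| ^+ 2 <= `|c i 0| ^+ 2.
  rewrite mul_diag_mx mxE normrM exprMn ger0_norm //.
  have /real_leP := ger0_real (d0 i) => /(_ 1 (ger0_real ler01))[d1|d1].
    by rewrite ler_piMl ?exprn_ge0 // exprn_ile1.
  by rewrite c0 // normr0 expr0n mulr0.
split=> [|ge]; first exact: ler_sum.
congr (_ *m _).
have : \sum_i (`|c i 0| ^+ 2 - `|(diag_mx d *m c) i 0| ^+ 2) == 0.
  by rewrite eq_le sumr_ge0 ?andbT ?sumrB ?subr_le0 // => i _; rewrite subr_ge0.
rewrite psumr_eq0 => [/allP h|i _]; last by rewrite subr_ge0.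
rewrite mulmx_diag mul_diag_mx; apply/colP => i; rewrite !mxE -expr2.
have := h i; rewrite mem_index_enum => /(_ isT) /=.
rewrite mul_diag_mx mxE normrM exprMn ger0_norm // -[X in X - _]mul1r -mulrBl.
rewrite mulf_eq0 subr_eq0 => /orP[/eqP <-|]; first by rewrite mul1r.
by rewrite expf_eq0 /= normr_eq0 => /eqP ->; rewrite mulr0.
Qed.
End Singular.

(** * The antilinear involution of a coninvolutory matrix *)

Section Coninvolutory.
Variables (C : numClosedFieldType) (n : nat) (A : 'M[C]_n).
Hypothesis hA : A *m conj_mx A = 1%:M.

(** The map [J], applied to all columns of [y] at once. *)
Definition conact q (y : 'M[C]_(n, q)) := conj_mx (A *m y).

Lemma coninvolutory_unit : A \in unitmx.
Proof. by case/mulmx1_unit: hA. Qed.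

Lemma coninvolutory_adj : A ^t* *m conj_mx (A ^t*) = 1%:M.
Proof. by apply: mulmx1C; rewrite -adj_conj -adjM hA trmx1 map_mx1. Qed.

Lemma conactK q : involutive (@conact q).
Proof.
move=> y.
by rewrite /conact map_mxM /= conj_mxK mulmxA (mulmx1C hA) mul1mx.
Qed.

Lemma singular_family_conj p (U V : 'M[C]_(n, p)) (d : 'rV[C]_p) :
  (forall i, 0 < d 0 i) -> singular_family A U V d ->
  singular_family A (conj_mx V) (conj_mx U) (map_mx (fun x => 1 / x) d).
Proof.
move=> d0 [d0' h1 h2].
have inv (B : 'M[C]_n) (X Y : 'M[C]_(n, p)) : B *m conj_mx B = 1%:M ->
    B *m X = Y *m diag_mx d ->
    B *m conj_mx Y = conj_mx X *m diag_mx (map_mx (fun x => 1 / x) d).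
  move=> hB /(congr1 (fun Z => B *m conj_mx Z)).
  rewrite !map_mxM /= mulmxA hB mul1mx conj_diag // mulmxA => ->.
  by rewrite -mulmxA diag_inv // mulmx1.
split=> [i||]; first by rewrite mxE divr_ge0 ?ler01.
  exact: inv.
exact: inv coninvolutory_adj _.
Qed.

(** Moves [J] to the other side of the scalar product. *)
Lemma adj_mul_conact p q (X : 'M[C]_(n, p)) (y : 'M[C]_(n, q)) :
  X ^t* *m conact y = conj_mx ((A ^t* *m conj_mx X) ^t* *m y).
Proof.
rewrite adjM trmxCK adj_conj /conact !map_mxM /=.
by rewrite conj_mxK mulmxA.
Qed.

(** [A^H] maps the conjugate of [V | conj(U)] to [conj(U) | V] up to scaling of
    the columns, so [J] preserves orthogonality to these columns. *)
Lemma conact_stable_family p q (U V : 'M[C]_(n, p)) (d : 'rV[C]_p)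
    (y : 'M[C]_(n, q)) :
  (forall i, 0 < d 0 i) -> singular_family A U V d ->
  (row_mx V (conj_mx U)) ^t* *m y = 0 ->
  (row_mx V (conj_mx U)) ^t* *m conact y = 0.
Proof.
move=> d0 F; have [_ _ h2] := F.
have [_ _ h2'] := singular_family_conj d0 F.
rewrite !adj_row_mx !mul_col_mx => /eqP.
rewrite col_mx_eq0 => /andP[/eqP Vy /eqP Uy].
rewrite !adj_mul_conact h2' conj_mxK h2 !adjM -!mulmxA Uy Vy.
by rewrite !mulmx0 map_mx0 col_mx0.
Qed.

(** If [y] is orthogonal to [X], then so is [y + J y], which is fixed by [J]; when
    it vanishes, [J y = - y] and [i y] is fixed instead, since [J] is antilinear.
    Normalizing by a real factor keeps the vector fixed. *)
Lemma conact_fixed_vector p (X : 'M[C]_(n, p)) : (p < n)%N ->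
  (forall y : 'cV[C]_n, X ^t* *m y = 0 -> X ^t* *m conact y = 0) ->
  exists w : 'cV[C]_n, [/\ orthonormal w, X ^t* *m w = 0 & conact w = w].
Proof.
move=> ltpn stX; have [y y0 Xy] := nonzero_orthogonal_vector X ltpn.
have conactZ a (z : 'cV[C]_n) : conact (a *: z) = conjC a *: conact z.
  by rewrite /conact -scalemxAr map_mxZ.
have conactD (z z' : 'cV[C]_n) : conact (z + z') = conact z + conact z'.
  by rewrite /conact mulmxDr map_mxD.
have [z [z0 Xz Jz]] : exists z : 'cV[C]_n,
    [/\ z != 0, X ^t* *m z = 0 & conact z = z].
  have [e|nz] := eqVneq (y + conact y) 0.
    exists ('i *: y); split.
    - by rewrite scaler_eq0 negb_or neq0Ci.
    - by rewrite -scalemxAr Xy scaler0.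
    - move/eqP: e; rewrite addrC addr_eq0 => /eqP Jy.
      by rewrite conactZ Jy conjCi scalerN scaleNr opprK.
  exists (y + conact y); split=> //.
    by rewrite mulmxDr Xy stX // addr0.
  by rewrite conactD conactK addrC.
pose N := (z ^t* *m z) 0 0.
have N0 : 0 < N.
  rewrite lt_def /N adj_mul_self sumr_ge0 ?andbT => [|i _]; last exact: exprn_ge0.
  rewrite -adj_mul_self -/N; apply: contraNneq z0 => e.
  by rewrite -adj_mul_eq0; apply/eqP/matrixP => a b; rewrite !ord1 -/N e mxE.
have r0 : 0 < sqrtC N by rewrite sqrtC_gt0.
have rr : conjC (sqrtC N)^-1 = (sqrtC N)^-1 by rewrite geC0_conj // invr_ge0 ltW.
exists ((sqrtC N)^-1 *: z); split.
- rewrite /orthonormal; have -> : ((sqrtC N)^-1 *: z) ^t* = (sqrtC N)^-1 *: z ^t*.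
    by apply/matrixP => a b; rewrite !mxE rmorphM /= rr.
  rewrite -scalemxAl -scalemxAr scalerA.
  have -> : z ^t* *m z = N%:M by rewrite [LHS]mx11_scalar.
  by rewrite scale_scalar_mx -expr2 exprVn sqrtCK ?mulVf // gt_eqF.
- by rewrite -scalemxAr Xz scaler0.
- by rewrite conactZ rr Jz.
Qed.

(** The hypotheses say that on the orthogonal complement of [X] the map [J] is a
    real structure compatible with the scalar product.  They pass to [X] extended
    by a fixed vector [w]: since [A^H conj(w) = A^H A w = w], the scalar product of
    [w] with [J y] is the conjugate of that of [w] with [y]. *)
Lemma conact_fixed_basis k p (X : 'M[C]_(n, p)) :
  (p + k)%N = n -> orthonormal X ->
  (forall y : 'cV[C]_n, X ^t* *m y = 0 -> X ^t* *m conact y = 0) ->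
  (forall y : 'cV[C]_n, X ^t* *m y = 0 -> A ^t* *m A *m y = y) ->
  exists W : 'M[C]_(n, k),
    [/\ orthonormal W, X ^t* *m W = 0 &
        singular_family A (conj_mx W) W (const_mx 1)].
Proof.
elim: k p X => [|k IHk] p X pk oX stX fixX.
  exists 0; split; [by apply/matrixP=> [[]]|by rewrite mulmx0|].
  by apply/singular_familyP => -[].
have ltpn : (p < n)%N by rewrite -pk addnS ltnS leq_addr.
have [w [ow Xw Jw]] := conact_fixed_vector ltpn stX.
have Aw : A *m w = conj_mx w by rewrite -[in RHS]Jw /conact conj_mxK.
have AHw : A ^t* *m conj_mx w = w by rewrite -Aw mulmxA fixX.
have Xw_eq0 (y : 'cV[C]_n) : (row_mx X w) ^t* *m y = 0 ->
    X ^t* *m y = 0 /\ w ^t* *m y = 0.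
  rewrite adj_row_mx mul_col_mx => /eqP.
  by rewrite col_mx_eq0 => /andP[/eqP -> /eqP ->].
have pk' : ((p + 1) + k)%N = n by rewrite addn1 addSnnS.
have oXw : orthonormal (row_mx X w) by apply/orthonormal_row_mx.
have [|y /Xw_eq0[/fixX] //|W [oW XW FW]] := IHk _ (row_mx X w) pk' oXw.
  move=> y /Xw_eq0[Xy wy]; rewrite adj_row_mx mul_col_mx stX // adj_mul_conact.
  by rewrite AHw wy map_mx0 col_mx0.
move: XW; rewrite adj_row_mx mul_col_mx => /eqP.
rewrite col_mx_eq0 => /andP[/eqP XW /eqP wW].
have Fw : singular_family A (conj_mx w) w (const_mx 1).
  by rewrite /singular_family diag_const_mx !mulmx1; split=> // i; rewrite mxE.
have owW : orthonormal (row_mx w W) by apply/orthonormal_row_mx.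
have FwW := singular_family_row Fw FW.
rewrite -map_row_mx row_mx_const in FwW.
have XwW : X ^t* *m row_mx w W = 0 by rewrite mul_mx_row Xw XW row_mx0.
by exists (row_mx w W).
Qed.

(** The singular values of the blocks [V1], [conj(U1)] and [V2 | conj(U2)] are
    respectively [> 1], [< 1] and [= 1], so the blocks are orthogonal. *)
Lemma paired_orthonormal nu mu (U1 V1 : 'M[C]_(n, nu)) (sigma : 'rV[C]_nu)
    (U2 V2 : 'M[C]_(n, mu)) :
  (forall j, 1 < sigma 0 j) ->
  singular_family A U1 V1 sigma -> singular_family A U2 V2 (const_mx 1) ->
  orthonormal V1 -> orthonormal (row_mx V2 (conj_mx U2)) ->
  orthonormal (row_mx (row_mx V1 V2) (conj_mx (row_mx U1 U2))).
Proof.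
move=> s1 F1 F2 oV1 oVU2; rewrite map_row_mx.
have s0 j : 0 < sigma 0 j by exact: lt_trans (s1 j).
have s1' j : (map_mx (fun x => 1 / x) sigma) 0 j < 1.
  by rewrite mxE mul1r invf_lt1.
have one0 j : 0 < (const_mx 1 : 'rV[C]_mu) 0 j by rewrite mxE.
have F1c := singular_family_conj s0 F1.
have F2c := singular_family_conj one0 F2.
have oU1 := singular_family_orthonormal_left s0 F1 oV1.
have one1 j : (map_mx (fun x => 1 / x) (const_mx 1 : 'rV[C]_mu)) 0 j = 1.
  by rewrite !mxE divr1.
have [oV2 oU2 VU2] := (orthonormal_row_mx V2 (conj_mx U2)).1 oVU2.
apply: orthonormal_shuffle; apply/orthonormal_row_mx; split=> //.
  apply/orthonormal_row_mx; split=> //; first exact: orthonormal_conj.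
  apply: singular_family_orth F1 F1c => i j.
  by rewrite gt_eqF // (lt_trans (s1' j)).
have F2' := singular_family_row F2 F2c; have F1' := singular_family_row F1 F1c.
apply: singular_family_orth F1' F2' => i j.
have -> : row_mx (const_mx 1 : 'rV[C]_mu)
    (map_mx (fun x => 1 / x) (const_mx 1 : 'rV[C]_mu)) 0 j = 1.
  by rewrite mxE; case: split => k; rewrite ?one1 ?mxE.
rewrite mxE; case: split => k; first by rewrite gt_eqF.
by rewrite lt_eqF.
Qed.

(** [J] maps the complement of [X] to itself without increasing norms there, and
    [J] is an involution, so [|y| = |J (J y)| <= |J y| <= |y|] are equalities. *)
Lemma conact_orth_fixed p (X : 'M[C]_(n, p)) (U V : 'M[C]_n) (d : 'rV[C]_n) :
  has_svd A U V d ->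
  (forall y : 'cV[C]_n, X ^t* *m y = 0 -> X ^t* *m conact y = 0) ->
  (forall (y : 'cV[C]_n) i, 1 < d 0 i -> X ^t* *m y = 0 ->
     (V ^t* *m y) i 0 = 0) ->
  forall y : 'cV[C]_n, X ^t* *m y = 0 -> A ^t* *m A *m y = y.
Proof.
move=> S stX X_gt1 y Xy.
have normJ (z : 'cV[C]_n) :
    ((conact z) ^t* *m conact z) 0 0 = ((A *m z) ^t* *m (A *m z)) 0 0.
  by rewrite !adj_mul_self; apply: eq_bigr => i _; rewrite mxE norm_conjC.
have [_ ] := svd_contraction S (fun i di => X_gt1 y i di Xy); apply.
have [+ _] := svd_contraction S (fun i di => X_gt1 _ i di (stX y Xy)).
by rewrite -(normJ (conact y)) conactK normJ.
Qed.

(** The whole structure, for a chosen injection [f] onto the positions of the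
    singular values [> 1] in a given decomposition. *)
Lemma coninvolutory_svd nu mu (U V : 'M[C]_n) (d : 'rV[C]_n)
    (f : 'I_nu -> 'I_n) (U2 V2 : 'M[C]_(n, mu)) :
  has_svd A U V d -> injective f -> (forall j, 1 < d 0 (f j)) ->
  (forall i, 1 < d 0 i -> exists j, i = f j) ->
  singular_family A U2 V2 (const_mx 1) ->
  orthonormal (row_mx V2 (conj_mx U2)) ->
  let U1 := colsub f U in let V1 := colsub f V in
  let X := row_mx (row_mx V1 V2) (conj_mx (row_mx U1 U2)) in
  [/\ singular_family A U1 V1 (\row_j d 0 (f j)), orthonormal X &
      forall k, (((nu + mu) + (nu + mu)) + k)%N = n ->
      exists W : 'M[C]_(n, k), orthonormal (row_mx X W) /\
        singular_family A (conj_mx W) W (const_mx 1)].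
Proof.
move=> S f_inj d1 d1f F2 oVU2 U1 V1 X.
have [oU oV F] := (has_svdP A U V d).1 S.
have F1 : singular_family A U1 V1 (\row_j d 0 (f j)).
  exact: singular_family_colsub.
have s1 j : 1 < (\row_j d 0 (f j)) 0 j by rewrite mxE.
have oX : orthonormal X.
  by apply: paired_orthonormal F1 F2 _ oVU2 => //; exact: orthonormal_colsub.
split=> // k nk.
pose s : 'rV[C]_(nu + mu) := row_mx (\row_j d 0 (f j)) (const_mx 1).
have s0 i : 0 < s 0 i.
  rewrite mxE; case: split => j; first exact: lt_trans (s1 j).
  by rewrite mxE.
have stX (y : 'cV[C]_n) : X ^t* *m y = 0 -> X ^t* *m conact y = 0.
  by apply: conact_stable_family s0 _; exact: singular_family_row.
have [y i di Xy|W [oW XW FW]] :=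
  conact_fixed_basis nk oX stX (conact_orth_fixed S stX _).
  have [j ->] := d1f i di; move: Xy; rewrite !adj_row_mx !mul_col_mx => /eqP.
  rewrite !col_mx_eq0 -andbA => /and3P[/eqP V1y _ _].
  have -> : (V ^t* *m y) (f j) 0 = (V1 ^t* *m y) j 0.
    by rewrite !mxE; apply: eq_bigr => l _; rewrite !mxE.
  by rewrite V1y mxE.
by exists W; split=> //; apply/orthonormal_row_mx.
Qed.

End Coninvolutory.

(** * Decompositions with a real diagonal *)

Section Bridge.
Variable R : realType.
Local Notation toC := (map_mx (real_complex R)).

Lemma is_svdP n (A U V : 'M[R[i]]_n) (d : 'rV[R]_n) :
  is_svd A U V d <-> has_svd A U V (toC d).
Proof.
split=> -[h1 h2 h3 h4]; split=> // i; first by rewrite mxE ler0c.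
by have := h3 i; rewrite mxE ler0c.
Qed.

(** The default value in the definition of [singular_values] is not reached. *)
Lemma singular_values_svd n (A : 'M[R[i]]_n) : A \in unitmx ->
  exists U V d, is_svd A U V d /\ singular_values A = [seq d 0 i | i : 'I_n].
Proof.
move=> uA; rewrite /singular_values; case: xgetP => [d _ [U [V S]]|noS].
  by exists U, V; eexists; split; [exact: S|].
have [U [V [d S]]] := svd_exists uA; have [_ _ d0 _] := S.
pose dR := map_mx (@complex.Re R) d.
have dE : toC dR = d.
  by apply/rowP => i; rewrite !mxE RRe_real // ger0_real.
by case: (noS dR); exists U, V; apply/is_svdP; rewrite dE.
Qed.

Lemma is_svd_unique n (A U V U' V' : 'M[R[i]]_n) (d d' : 'rV[R]_n) :
  is_svd A U V d -> is_svd A U' V' d' ->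
  perm_eq [seq d 0 i | i : 'I_n] [seq d' 0 i | i : 'I_n].
Proof.
move=> /is_svdP S /is_svdP S'; apply: (perm_map_inj (@complexI R)).
have r (e : 'rV[R]_n) : map (real_complex R) [seq e 0 i | i : 'I_n] =
    [seq (toC e) 0 i | i : 'I_n].
  by rewrite -map_comp; apply: eq_map => i /=; rewrite mxE.
by have := svd_unique S S'; rewrite -!r.
Qed.

Lemma singular_values_of_svd n (A U V : 'M[R[i]]_n) (d : 'rV[R]_n) :
  A \in unitmx -> is_svd A U V d ->
  perm_eq (singular_values A) [seq d 0 i | i : 'I_n].
Proof.
move=> uA S; have [U' [V' [d' [S' ->]]]] := singular_values_svd uA.
exact: is_svd_unique S' S.
Qed.

Lemma singular_family_triplet n p (A : 'M[R[i]]_n) (U V : 'M[R[i]]_(n, p))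
    (d : 'rV[R]_p) j :
  orthonormal U -> orthonormal V -> singular_family A U V (toC d) ->
  singular_triplet A (col j U) (col j V) (d 0 j).
Proof.
move=> oU oV /singular_familyP/(_ j); rewrite mxE => -[d0 h1 h2]; split=> //.
- by rewrite -ler0c.
- exact: (orthonormal_col j oU).
- exact: (orthonormal_col j oV).
Qed.

Lemma is_svd_cast n p (A : 'M[R[i]]_n) (e : p = n) (U V : 'M[R[i]]_(n, p))
    (d : 'rV[R]_p) :
  orthonormal U -> orthonormal V -> singular_family A U V (toC d) ->
  is_svd A (castmx (erefl n, e) U) (castmx (erefl n, e) V)
           (castmx (erefl 1%N, e) d).
Proof.
case: n / e A U V => A U V oU oV F; rewrite !castmx_id.
by apply/is_svdP/has_svdP.
Qed.

Lemma entries_castmx n p (e : p = n) (d : 'rV[R]_p) :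
  [seq (castmx (erefl 1%N, e) d) 0 i | i : 'I_n] = [seq d 0 i | i : 'I_p].
Proof. by case: n / e; rewrite castmx_id. Qed.

Lemma count_row_mx p q (d : 'rV[R]_p) (d' : 'rV[R]_q) a :
  count a [seq (row_mx d d') 0 i | i : 'I_(p + q)] =
  (count a [seq d 0%R i | i : 'I_p] + count a [seq d' 0%R i | i : 'I_q])%N.
Proof.
rewrite -!sum1_count !big_map big_split_ord /=.
by congr (_ + _)%N; apply: eq_bigl => i; rewrite ?row_mxEl ?row_mxEr.
Qed.

Lemma count_const_mx p (c : R) a :
  count a [seq (const_mx c : 'rV[R]_p) 0 i | i : 'I_p] = (a c * p)%N.
Proof.
rewrite -sum1_count big_map /=; under eq_bigl do rewrite mxE.
case: (a c); rewrite ?big_pred0_eq //.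
by rewrite big_enum sum_nat_const card_ord muln1 mul1n.
Qed.

End Bridge.

(* U1, V1, U2, V2, W collect, as columns, the vectors u_1..u_nu, v_1..v_nu,
   u_(nu+1)..u_(nu+mu), v_(nu+1)..v_(nu+mu) and
   u_(nu+mu+1)..u_(nu+mu+delta+eta).  In the conclusion, eta and delta are
   natural numbers; the truncated subtraction is exact by the first conjunct. *)
Theorem theorem7 (R : realType) (n m : nat) (hn : n = (2 * m)%N \/ n = (2 * m + 1)%N)
    (A : 'M[R[i]]_n) (hA : A *m conj_mx A = 1%:M)
    (nu : nat) (sigma : 'rV[R]_nu)
    (hsigma : perm_eq [seq sigma 0 j | j : 'I_nu]
                      [seq s <- singular_values A | 1 < s])
    (hsorted : forall i j : 'I_nu, (i <= j)%N -> sigma 0 j <= sigma 0 i)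
    (mu : nat) (U2 V2 : 'M[R[i]]_(n, mu))
    (htriplet : forall j : 'I_mu,
       singular_triplet A (col j U2) (col j V2) 1 /\
       singular_triplet A (conj_mx (col j V2)) (conj_mx (col j U2)) 1)
    (horth : orthonormal_cols (row_mx V2 (conj_mx U2))) :
  0 <= m%:Z - nu%:Z - mu%:Z :> int /\
  let eta := (m - nu - mu)%N in
  let delta := if n == (2 * m)%N then eta else (eta + 1)%N in
  exists (U1 V1 : 'M[R[i]]_(n, nu)) (W : 'M[R[i]]_(n, delta + eta))
         (alpha : 'I_(delta + eta) -> R),
    [/\ forall j : 'I_nu,
          singular_triplet A (col j U1) (col j V1) (sigma 0 j) /\
          singular_triplet A (conj_mx (col j V1)) (conj_mx (col j U1))
                           (1 / sigma 0 j),
        forall j : 'I_(delta + eta),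
          singular_triplet A (col j W)
                           (expi (alpha j) *: (conj_mx (col j W))) 1,
        n%:Z - 2 * nu%:Z - 2 * mu%:Z = (delta + eta)%:Z :> int,
        perm_eq (singular_values A)
          ([seq sigma 0 j | j : 'I_nu] ++ [seq 1 / sigma 0 j | j : 'I_nu] ++
           nseq (2 * mu) 1 ++ nseq (delta + eta) 1)
      & exists e : (((nu + mu) + delta) + ((nu + mu) + eta))%N = n,
          let W' := \matrix_(i, j) (expi (alpha j) * (W i j)^*%R)
            : 'M[R[i]]_(n, delta + eta) in
          let U := row_mx
            (row_mx (row_mx U1 U2) (lsubmx W))
            (row_mx (row_mx (conj_mx V1) (conj_mx V2)) (rsubmx W)) in
          let V := row_mx
            (row_mx (row_mx V1 V2) (lsubmx W'))
            (row_mx (row_mx (conj_mx U1) (conj_mx U2)) (rsubmx W')) in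
          let d := row_mx
            (row_mx (row_mx sigma (const_mx 1 : 'rV_mu)) (const_mx 1 : 'rV_delta))
            (row_mx (row_mx (map_mx (fun x => 1 / x) sigma) (const_mx 1 : 'rV_mu))
                    (const_mx 1 : 'rV_eta)) in
          is_svd A (castmx (erefl n, e) U) (castmx (erefl n, e) V)
                   (castmx (erefl 1%N, e) d)].
Proof.
pose toC p := @map_mx _ _ (real_complex R) 1 p.
have uA := coninvolutory_unit hA.
have [U0 [V0 [d0 [S0 sv]]]] := singular_values_svd uA.
rewrite sv in hsigma.
have [f [f_inj fsigma f_onto]] := select_indices hsigma.
have sigma1 j : 1 < sigma 0 j.
  have : sigma 0 j \in [seq sigma 0 j | j : 'I_nu] by apply: map_f; rewrite mem_enum.
  by rewrite (perm_mem hsigma) mem_filter => /andP[].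
have F2 : singular_family A U2 V2 (const_mx 1).
  apply/singular_familyP => j; rewrite mxE.
  by have [[_ _ _ h1 h2] _] := htriplet j; split; [exact: ler01| |].
have toC_gt1 (x : R) : (1 < x%:C) = (1 < x) by rewrite -ltcR.
have [||F1 oX hW] :=
  coninvolutory_svd hA ((is_svdP _ _ _ _).1 S0) f_inj _ _ F2 horth.
- by move=> j; rewrite mxE toC_gt1 -fsigma.
- by move=> i; rewrite mxE toC_gt1 => /f_onto.
set U1 := colsub f U0 in F1 oX hW; set V1 := colsub f V0 in F1 oX hW.
have sE : \row_j (toC _ d0) 0 (f j) = toC _ sigma.
  by apply/rowP => j; rewrite !mxE fsigma.
rewrite sE in F1.
have le := orthonormal_leq oX.
have le' : (nu + mu <= m)%N by case: hn => hn'; rewrite hn' in le; lia.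
split; first lia.
move=> eta delta.
have e : ((nu + mu) + (nu + mu) + (delta + eta))%N = n.
  rewrite /delta /eta; case: eqP => hn'; lia.
have e' : (((nu + mu) + delta) + ((nu + mu) + eta))%N = n by lia.
have [W [oXW FW]] := hW _ e.
clearbody delta eta.
have expi0 : expi 0 = 1 :> R[i] by rewrite /expi cos0 sin0.
have [_ oW _] := (orthonormal_row_mx _ W).1 oXW.
have [/orthonormal_row_mx[oV1 _ _] oU12 _] := (orthonormal_row_mx _ _).1 oX.
have s0 j : 0 < (toC _ sigma) 0 j.
  by rewrite mxE ltcR (lt_trans _ (sigma1 j)).
have oU1 := singular_family_orthonormal_left s0 F1 oV1.
have F1c := singular_family_conj hA s0 F1.
have one0 p j : 0 < (const_mx 1 : 'rV[R[i]]_p) 0 j by rewrite mxE.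
have invE : map_mx (fun x => 1 / x) (toC _ sigma) =
            toC _ (map_mx (fun x => 1 / x) sigma).
  by apply/rowP => j; rewrite !mxE fmorph_div rmorph1.
rewrite invE in F1c.
have oneE p : toC p (const_mx 1) = const_mx 1 by rewrite /toC map_const_mx.
have F2c := singular_family_conj hA (one0 mu) F2.
have inv1 : map_mx (fun x => 1 / x) (const_mx 1 : 'rV[R[i]]_mu) = const_mx 1.
  by apply/rowP => j; rewrite !mxE divr1.
rewrite inv1 in F2c.
(* Serves both halves of [W], as [g] ranges over the two injections of indices. *)
have F1W q (g : 'I_q -> 'I_(delta + eta)) :
    singular_family A (colsub g (conj_mx W)) (colsub g W) (const_mx 1).
  have := singular_family_colsub g FW; congr singular_family.
  by apply/rowP => j; rewrite !mxE.
have FV := singular_family_row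
  (singular_family_row (singular_family_row F1 F2) (F1W _ (lshift eta)))
  (singular_family_row (singular_family_row F1c F2c) (F1W _ (@rshift delta eta))).
rewrite -!lsubmxEsub -!rsubmxEsub -!oneE -!map_row_mx in FV.
rewrite [conj_mx (row_mx V1 V2)]map_row_mx [conj_mx (row_mx U1 U2)]map_row_mx in FV.
have oV : orthonormal
    (row_mx (row_mx (row_mx V1 V2) (lsubmx W))
            (row_mx (row_mx (conj_mx U1) (conj_mx U2)) (rsubmx W))).
  by apply: orthonormal_shuffle; rewrite hsubmxK -map_row_mx.
have d_gt0 : forall j, 0 < (toC _ (row_mx
    (row_mx (row_mx sigma (const_mx 1 : 'rV_mu)) (const_mx 1 : 'rV_delta))
    (row_mx (row_mx (map_mx (fun x => 1 / x) sigma) (const_mx 1 : 'rV_mu))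
            (const_mx 1 : 'rV_eta)))) 0 j.
  move=> j; rewrite mxE ltcR; do 3?[rewrite mxE; case: split => {}j].
  all: rewrite ?mxE ?mul1r ?invr_gt0 ?ltr01 //.
  all: try exact: lt_trans ltr01 (sigma1 _).
have oU := singular_family_orthonormal_left d_gt0 FV oV.
have svdA := is_svd_cast e' oU oV FV.
have WE : \matrix_(i, j) (expi 0 * ((conj_mx W) i j)^*%R) = W.
  by apply/matrixP => i j; rewrite !mxE expi0 mul1r conjCK.
(* [W] holds the right vectors; the statement asks for the left ones. *)
exists U1, V1, (conj_mx W), (fun=> 0); split.
- move=> j; split; first exact: singular_family_triplet oU1 oV1 F1.
  have := singular_family_triplet j (orthonormal_conj oV1)
    (orthonormal_conj oU1) F1c.
  by rewrite !map_col !mxE.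
- move=> j; rewrite expi0 scale1r -map_col conj_mxK.
  rewrite -(oneE (delta + eta)%N) in FW.
  have := singular_family_triplet j (orthonormal_conj oW) oW FW.
  by rewrite mxE map_col.
- lia.
- rewrite (permPl (singular_values_of_svd uA svdA)).
  rewrite entries_castmx; apply/permP => a.
  rewrite !count_row_mx !count_const_mx !count_cat !count_nseq.
  have -> : [seq (map_mx (fun x => 1 / x) sigma) 0 j | j : 'I_nu] =
            [seq 1 / sigma 0 j | j : 'I_nu].
    by apply: eq_map => j; rewrite mxE.
  have regroup (x y b p q r : nat) :
      (x + b * p + b * q + (y + b * p + b * r) =
       x + (y + (b * (2 * p) + b * (q + r))))%N by nia.
  exact: regroup.
- by exists e'; rewrite WE.
Qed.
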